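(* The following two equalities hold: (1) $\mathsf{\Delta}=\min\{|H|:H\subseteq I_\omega\ \wedge\ \forall A\in[\omega]^\omega\ \exists h\in H\ \ (h[A]\cap A\in[\omega]^\omega)\}$; (2) $\mathsf{\Sigma}=\min\{|H|:H\subseteq I_\omega\ \wedge\ \forall A,B\in[\omega]^\omega\ \exists h\in H\ \ (h[A]\cap B\in[\omega]^\omega)\}$.
   Context: $[\omega]^\omega$ is the family of all infinite subsets of $\omega$, $S_\omega$ is the group of all bijections of $\omega$, and $I_\omega\subset S_\omega$ is the set of all involutions $h$ of $\omega$ (i.e. $h\circ h=\mathrm{id}$) having at most one fixed point. Define $$\mathsf{\Delta}=\min\{|H|:H\subseteq S_\omega\ \wedge\ \forall A\in[\omega]^\omega\ \exists h\in H\ \ \{a\in A:a\ne h(a)\in A\}\in[\omega]^\omega\},$$ $$\mathsf{\Sigma}=\min\{|H|:H\subseteq S_\omega\ \wedge\ \forall A,B\in[\omega]^\omega\ \exists h\in H\ \ h[A]\cap B\in[\omega]^\omega\}.$$ *)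

(* Defs.v *)
From mathcomp Require Import all_boot.
From mathcomp Require Import boolp classical_sets functions cardinality.

Set Implicit Arguments.
Unset Strict Implicit.
Unset Printing Implicit Defensive.

Local Open Scope classical_set_scope.
Local Open Scope card_scope.

(* The library has no type of cardinals, so a cardinal is given by a set
   representing it and is meant up to equinumerosity [#=].  Thus
   [is_min_card F K] says that min {|H| : H in F} exists and equals |K|. *)
Definition is_min_card (T : Type) (F : set (set T)) (K : set T) : Prop :=
  (exists2 H, F H & H #= K) /\ (forall H, F H -> K #<= H).

(* The value set0 for F = set0 is junk; otherwise see [min_cardP]. *)
Definition min_card (T : Type) (F : set (set T)) : set T :=
  xget set0 (is_min_card F).

(* Take a maximal set M of choice functions f, f H \in H, on which evaluation at
   each member of F is injective: by maximality some evaluation is onto. *)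
Lemma is_min_card_exists (T : Type) (F : set (set T)) :
  F !=set0 -> exists K, is_min_card F K.
Proof.
move=> F0.
pose P (M : set (set T -> T)) := forall H, F H ->
  (forall f, M f -> H (f H)) /\
  (forall f g, M f -> M g -> f H = g H -> f = g).
have [|M [PM maxM]] := @Zorn_bigcup _ P.
  move=> C CP totC H FH; split=> [f [X CX Xf]|f g [X CX Xf] [Y CY Yg]].
    by have [+ _] := CP _ CX H FH; apply.
  have [XY|YX] := totC _ _ CX CY.
    by have [_] := CP _ CY H FH; apply => //; apply: XY.
  by have [_] := CP _ CX H FH; apply => //; apply: YX.
have [[K [FK KM]]|noK] :=
    pselect (exists K, F K /\ K `<=` (fun f => f K) @` M).
  have evK H : F H -> ((fun f : set T -> T => f H) @` M) #= M.
    move=> FH; apply: inj_card_eq => f g /set_mem Mf /set_mem Mg.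
    by have [_] := PM H FH; apply.
  have defK : (fun f => f K) @` M = K.
    by apply/seteqP; split=> // _ [f Mf <-]; have [+ _] := PM K FK; apply.
  exists K; split=> [|H FH]; first by exists K.
  rewrite -{1}defK (card_le_eql (evK _ FK)) -(card_le_eql (evK _ FH)).
  by apply: subset_card_le => _ [f Mf <-]; have [+ _] := PM H FH; apply.
have [t _] : exists t : T, True.
  have [K FK] := F0; apply: contrapT => noT; apply: noK.
  by exists K; split=> // x _; case: noT; exists x.
have missing H : exists x, F H -> H x /\ ~ ((fun f => f H) @` M) x.
  have [FH|nFH] := pselect (F H); last by exists t.
  apply: contrapT => no; apply: noK; exists H; split=> // x Hx.
  by apply: contrapT => nx; apply: no; exists x.
have [g gP] := choice missing.
have nMg : ~ M g.
  move=> Mg; have [H FH] := F0; have [_ ng] := gP H FH.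
  by apply: ng; exists g.
case: (maxM (M `|` [set g])).
  split; first by move=> f Mf; left.
  by move=> sub; apply: nMg; apply: sub; right.
move=> H FH; have [MH injM] := PM H FH; have [Hg ng] := gP H FH.
split=> [f [/MH|->]|f f' [Mf|->] [Mf'|->]] //.
- exact: injM.
- by move=> e; case: ng; exists f.
- by move=> e; case: ng; exists f'.
Qed.

Lemma min_cardP (T : Type) (F : set (set T)) :
  F !=set0 -> is_min_card F (min_card F).
Proof. by move=> /is_min_card_exists; apply: xgetPex. Qed.

(* [omega]^omega *)
Definition infinite_subsets : set (set nat) := [set A | infinite_set A].

Definition S_omega : set (nat -> nat) := [set h | bijective h].

Definition I_omega : set (nat -> nat) :=
  [set h | [/\ S_omega h, h \o h = id &
               forall x y, h x = x -> h y = y -> x = y]].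

Definition Delta : set (nat -> nat) :=
  min_card [set H | H `<=` S_omega /\
    forall A, infinite_subsets A ->
      exists2 h, H h & infinite_subsets [set a | [/\ A a, a <> h a & A (h a)]]].

Definition Sigma : set (nat -> nat) :=
  min_card [set H | H `<=` S_omega /\
    forall A B, infinite_subsets A -> infinite_subsets B ->
      exists2 h, H h & infinite_subsets ((h @` A) `&` B)].

(* Main.v *)
Require Import Defs.
From mathcomp Require Import all_boot.
From mathcomp Require Import boolp classical_sets functions cardinality.

(** A family of involutions with at most one fixed point that is good in the
    new sense is good in the old one: as h moves all points but at most one, an infinite
    h[A] meeting A infinitely gives infinitely many a in A with a <> h(a) in A.
    So each minimum over involutions is at least the original one.

    For the converse, the edges {x, h x} with h x <> x of a bijection h form a
    graph of degree at most 2, so greedily its vertices can be coloured with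
    three colours ([three_coloring]).  Giving the edge from x to h x the colour
    of x distributes the edges over three matchings.  A matching of omega extends to
    an involution with at most one fixed point, by matching up the remaining
    points as long as there are two of them ([matching_involution]).  So every
    h is replaced by three involutions such that every x moved by h is sent to
    h x by one of them, and an infinite set of moved points contains infinitely
    many on which the same involution agrees with h.  The new family witnesses
    the same property, for Delta at once and for Sigma because infinite sets A
    and B may first be shrunk to disjoint ones, so that only moved points matter
    ([Sigma_family_moving]).

    The new family has at most 3|H| members, and 3|H| = |H| because H is infinite:
    for a finite H, a maximal set A containing no edge of any h in H is infinite
    ([finite_family_independent_set]), contrary to the property defining Delta,
    which the one defining Sigma implies ([Sigma_sub_Delta]). *)

Set Implicit Arguments.
Unset Strict Implicit.
Unset Printing Implicit Defensive.

Local Open Scope classical_set_scope.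
Local Open Scope card_scope.

(** * Infinite sets and cardinals *)

Lemma infinite_image_inj (T U : Type) (f : T -> U) (A : set T) :
  injective f -> infinite_set A -> infinite_set (f @` A).
Proof.
move=> f_inj; apply: contra_not => finfA; apply: card_le_finite finfA.
have /card_esym : f @` A #= A by apply: inj_card_eq => x y _ _; apply: f_inj.
by rewrite card_eq_le => /andP[].
Qed.

Lemma infinite_range_inj (T : Type) (s : nat -> T) :
  injective s -> infinite_set (range s).
Proof. by move=> /infinite_image_inj; apply; apply: infinite_nat. Qed.

Lemma infinite_seq (T : Type) (A : set T) :
  infinite_set A -> exists2 s : nat -> T, injective s & forall n, A (s n).
Proof.
move=> infA; have [t _] := infinite_setN0 infA.
move/infiniteP/card_leP: infA => [f].
have /injfunPex [s sA s_inj] : $|{injfun [set: nat] >-> A}|.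
  by squash (valLR t f).
by exists s => [m n|n]; [apply: s_inj; apply: in_setT | apply: sA].
Qed.

(** If A and B meet in an infinite set, one sequence in the intersection is split
    into its even and odd terms; otherwise A \ B is still infinite. *)
Lemma disjoint_infinite_seqs (T : Type) (A B : set T) :
  infinite_set A -> infinite_set B ->
  exists s t : nat -> T, [/\ injective s, injective t,
    forall n, A (s n), forall n, B (t n) & forall m n, s m <> t n].
Proof.
move=> infA infB; have [infAB|finAB] := pselect (infinite_set (A `&` B)).
  have [s s_inj sAB] := infinite_seq infAB.
  exists (fun n => s n.*2), (fun n => s n.*2.+1); split.
  - by move=> m n /s_inj /double_inj.
  - by move=> m n /s_inj [/double_inj].
  - by move=> n; have [] := sAB n.*2.
  - by move=> n; have [] := sAB n.*2.+1.
  - by move=> m n /s_inj /(congr1 odd); rewrite /= !odd_double.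
have infAB : infinite_set (A `\` B).
  move=> fin; apply: infA; rewrite -(setDUK (@subIsetl _ A B)) setDIr setDv set0U.
  by rewrite finite_setU; split=> //; apply: contrapT.
have [s s_inj sAB] := infinite_seq infAB.
have [t t_inj tB] := infinite_seq infB.
exists s, t; split=> // [n|m n e]; first by have [] := sAB n.
by have [_] := sAB m; apply; rewrite e.
Qed.

(** X is, up to a finite remainder, partitioned into ranges of injective sequences,
    by maximality of a set M of such sequences with disjoint ranges.  So X has the
    size of M * nat (the finite remainder being absorbed), and nat * nat is
    equinumerous to nat. *)
Lemma card_le_setX_nat (T : Type) (X : set T) :
  infinite_set X -> X `*` [set: nat] #<= X.
Proof.
move=> infX; have [t0 _] := infinite_setN0 infX.
pose P (M : set (nat -> T)) := (forall s, M s -> forall n, X (s n)) /\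
  (forall s t, M s -> M t -> forall m n, s m = t n -> s = t /\ m = n).
have [F FP totF|M [[MX Minj] maxM]] := @Zorn_bigcup _ P.
  split=> [s [D FD Ds]|s t [D FD Ds] [E FE Et]].
    by have [+ _] := FP _ FD; apply.
  have [DE|ED] := totF _ _ FD FE.
    by have [_] := FP _ FE; apply => //; apply: DE.
  by have [_] := FP _ FD; apply => //; apply: ED.
pose Y := [set p.1 p.2 | p in M `*` [set: nat]].
have YX : Y `<=` X by move=> _ [[s n] [/= Ms _] <-]; apply: MX.
have finXY : finite_set (X `\` Y).
  apply: contrapT => /infinite_seq [e e_inj eXY].
  have nMe : ~ M e.
    by move=> Me; have [_] := eXY 0; apply; exists (e, 0).
  apply: (maxM (M `|` [set e])).
    by split=> [s Ms|sub]; [left | apply: nMe; apply: sub; right].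
  have eM s m n : M s -> s m <> e n.
    by move=> Ms E; have [_] := eXY n; apply; exists (s, m).
  split=> [s [/MX //|->] n|s t [Ms|->] [Mt|->] m n].
  - by have [] := eXY n.
  - exact: Minj.
  - by move/eM => /(_ Ms).
  - by move/esym/eM => /(_ Mt).
  - by move/e_inj.
have [s0 Ms0] : M !=set0.
  apply/set0P/eqP => M0; apply: infX.
  have -> // : X = X `\` Y.
  by rewrite /Y M0 set0X image_set0 setD0.
have [z zXY] : exists z : nat -> T, forall x, X x -> ~ Y x -> exists n, z n = x.
  have /finite_set_countable/countable_injP [f f_inj] := finXY.
  have /choice [z zP] : forall n, exists x, forall y, (X `\` Y) y -> f y = n -> y = x.
    move=> n; have [[x [Xx fx]]|nx] := pselect (exists x, (X `\` Y) x /\ f x = n).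
      by exists x => y XYy fy; apply: f_inj; rewrite ?fy ?fx //; apply: mem_set.
    by exists t0 => y XYy fy; case: nx; exists y.
  by exists z => x Xx nYx; exists (f x); apply/esym/zP.
(* The code of (n, i, j) stands for the pair (s n, j) when i = 0, and for the
   pair (z i', j) with z i' in the remainder when i = i' + 1. *)
pose g (p : (nat -> T) * nat) : T * nat :=
  if unpickle p.2 is Some (n, i, j) then
    (if i is i'.+1 then z i' else p.1 n, j) else (t0, 0).
have XM : X `*` [set: nat] #<= M `*` [set: nat].
  apply: card_le_trans (card_image_le g _); apply: subset_card_le.
  move=> [x j] [/= Xx _]; have [[[s n] [/= Ms _] <-]|nYx] := pselect (Y x).
    by exists (s, pickle (n, 0, j)) => //; rewrite /g /= pickleK.
  have [i <-] := zXY _ Xx nYx.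
  by exists (s0, pickle (0, i.+1, j)) => //; rewrite /g /= pickleK.
apply: card_le_trans XM _; apply: card_le_trans (subset_card_le YX).
suff: Y #= M `*` [set: nat] by rewrite card_eq_le => /andP[].
apply: inj_card_eq => -[s m] [t n] /set_mem [/= Ms _] /set_mem [/= Mt _] /= e.
by have [-> ->] := Minj _ _ Ms Mt _ _ e.
Qed.

Lemma is_min_card_coinitial (T : Type) (F F' : set (set T)) :
  F !=set0 -> F' `<=` F ->
  (forall H, F H -> exists2 H', F' H' & H' #<= H) ->
  is_min_card F' (min_card F).
Proof.
move=> /min_cardP [[H FH HK] minK] F'F FF'; split=> [|H' /F'F /minK //].
have [H' F'H' H'H] := FF' _ FH; exists H' => //.
rewrite card_eq_le minK ?andbT; last exact: F'F.
by move: HK; rewrite card_eq_le => /andP[HK _]; apply: card_le_trans HK.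
Qed.

(** * Splitting a bijection into three involutions *)

Definition matching (T : Type) (M : set (T * T)) :=
  [/\ forall x, ~ M (x, x),
      forall x y, M (x, y) -> M (y, x) &
      forall x y z, M (x, y) -> M (x, z) -> y = z].

(** In a maximal matching extending M at most one point is unmatched, since two
    such points could be matched with each other; q exchanges matched points. *)
Lemma matching_involution (T : Type) (M : set (T * T)) : matching M ->
  exists q : T -> T, [/\ q \o q = id,
    forall x y, q x = x -> q y = y -> x = y &
    forall x y, M (x, y) -> q x = y].
Proof.
move=> [Mirr Msym Mfun].
have [F FP totF|N [[Nirr Nsym Nfun] maxN]] :=
    @Zorn_bigcup _ [set N | matching (M `|` N)].
  have FP1 D : F D -> matching (M `|` D) by apply: FP.
  split.
  - by move=> x [/Mirr //|[D /FP1 [irr _ _] Dx]]; apply: (irr x); right.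
  - move=> x y [/Msym Mxy|[D FD Dxy]]; first by left.
    have [_ sym _] := FP1 _ FD; have [|Myx|Dyx] := sym x y; first by right.
      by left.
    by right; exists D.
  - move=> x y z [Mxy|[D FD Dxy]] [Mxz|[E FE Exz]].
    + exact: Mfun Mxy Mxz.
    + by have [_ _ fn] := FP1 _ FE; apply: (fn x); [left | right].
    + by have [_ _ fn] := FP1 _ FD; apply: (fn x); [right | left].
    + have [DE|ED] := totF _ _ FD FE.
        by have [_ _ fn] := FP1 _ FE; apply: (fn x); right => //; apply: DE.
      by have [_ _ fn] := FP1 _ FD; apply: (fn x); right => //; apply: ED.
pose K := M `|` N.
have /choice [q qP] : forall x, exists y,
    K (x, y) \/ ((forall z, ~ K (x, z)) /\ y = x).
  move=> x; have [[y Kxy]|no] := pselect (exists y, K (x, y)).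
    by exists y; left.
  by exists x; right; split=> // z Kxz; apply: no; exists z.
have qK x y : K (x, y) -> q x = y.
  by have [Kxq|[no _]] := qP x => [/(Nfun _ _ _ Kxq)//|/no].
have fixK x : q x = x -> forall y, ~ K (x, y).
  by move=> qx; have [|[]//] := qP x; rewrite qx => /Nirr.
exists q; split=> [|x y /fixK Kx /fixK Ky|x y Mxy]; last by apply: qK; left.
  apply/funext => x /=; have [/Nsym/qK //|[_ e]] := qP x.
  by rewrite e.
apply: contrapT => xy; apply: (maxN (N `|` [set (x, y); (y, x)])).
  split=> [p Np|sub]; first by left.
  by apply: (Kx y); right; apply: sub; right; left.
rewrite /= setUA; split.
- by move=> u [/Nirr //|[] [-> e]]; apply: xy.
- move=> u v [/Nsym|[] [-> ->]]; first by left.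
    by right; right.
  by right; left.
- move=> u v w [Kuv|[] [eu ev]] [Kuw|[] [eu' ew]]; subst.
  all: try by [|exact: Nfun Kuv Kuw|case: (Kx v)|case: (Ky v)|case: (Kx w)
              |case: (Ky w)|case: xy].
Qed.

Lemma matching_I_omega (M : set (nat * nat)) : matching M ->
  exists2 q, I_omega q & forall x y, M (x, y) -> q x = y.
Proof.
move=> /matching_involution [q [qq qfix qM]]; exists q => //; split=> //.
by exists q => x; rewrite -[RHS](congr1 (@^~ x) qq).
Qed.

(** The points 0, 1, 2, ... are coloured in this order: n has at most two
    neighbours, h n and h^-1 n, so one of three colours is free. *)
Lemma three_coloring (h : nat -> nat) : bijective h ->
  exists c : nat -> 'I_3, forall n, h n <> n -> c (h n) <> c n.
Proof.
case=> h' hK h'K.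
pose avoid (a b : nat) := if (a != 0) && (b != 0) then 0
  else if (a != 1) && (b != 1) then 1 else 2.
have avoidP a b : [/\ avoid a b < 3, avoid a b <> a & avoid a b <> b].
  by case: a b => [|[|[|a]]] [|[|[|b]]].
(* cs n lists the colours of 0, ..., n - 1; the default 3 stands for a neighbour
   not coloured yet, and excludes no colour. *)
pose cs := fix cs n := if n is n'.+1 then
  rcons (cs n') (avoid (nth 3 (cs n') (h n')) (nth 3 (cs n') (h' n'))) else [::].
have size_cs n : size (cs n) = n by elim: n => //= n IHn; rewrite size_rcons IHn.
pose c n := nth 3 (cs n.+1) n.
have csE n m : m < n -> nth 3 (cs n) m = c m.
  elim: n => // n IHn; rewrite ltnS leq_eqVlt => /predU1P[-> //|lt_mn].
  by rewrite /= nth_rcons size_cs lt_mn IHn.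
have cE n : c n = avoid (nth 3 (cs n) (h n)) (nth 3 (cs n) (h' n)).
  by rewrite /c /= nth_rcons size_cs ltnn eqxx.
have c3 n : c n < 3.
  by rewrite cE; have [] := avoidP (nth 3 (cs n) (h n)) (nth 3 (cs n) (h' n)).
exists (fun n => Ordinal (c3 n)) => n hn /(congr1 val) /=.
have [lt|lt|//] := ltngtP (h n) n.
  by rewrite (cE n) csE //; have [_ /nesym] := avoidP (c (h n)) (nth 3 (cs n) (h' n)).
rewrite (cE (h n)) hK (csE _ n) //.
by have [] := avoidP (nth 3 (cs (h n)) (h (h n))) (c n).
Qed.

(** The edge from x to h x gets the colour of x.  The edges of one colour form
    a matching: at a point x moved by h, the edge leaving x has the colour of x,
    while the edge entering x has the colour of h^-1 x, a different one. *)
Lemma three_involutions (h : nat -> nat) : S_omega h ->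
  exists g : 'I_3 -> nat -> nat, (forall i, I_omega (g i)) /\
    forall x, h x <> x -> exists i, g i x = h x.
Proof.
move=> h_bij; have [c cP] := three_coloring h_bij; have h_inj := bij_inj h_bij.
pose M i : set (nat * nat) := [set p | p.1 <> p.2 /\
  (h p.1 = p.2 /\ c p.1 = i \/ h p.2 = p.1 /\ c p.2 = i)].
have Mmatching i : matching (M i).
  split=> [x [] //|x y [/= xy hxy]|x y z [/= xy hxy] [/= xz hxz]].
    by split=> /=; [exact: nesym | case: hxy; [right | left]].
  case: hxy hxz => -[hxy cx] [] [hxz cz].
  - by rewrite -hxy.
  - by case: (cP z); rewrite hxz; [| rewrite cx cz].
  - by case: (cP y); rewrite hxy; [| rewrite cx cz].
  - by apply: h_inj; rewrite hxy.
have /choice [g gP] : forall i, exists q,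
    I_omega q /\ forall x y, M i (x, y) -> q x = y.
  by move=> i; have [q ? ?] := matching_I_omega (Mmatching i); exists q.
exists g; split=> [i|x hx]; first by have [] := gP i.
exists (c x); have [_] := gP (c x); apply; split=> /=; first exact: nesym.
by left.
Qed.

(** Pigeonhole: E is the union of the three sets on which one of the
    involutions agrees with h.  The involutions are indexed by nat, with
    repetitions, to fit [card_le_setX_nat]. *)
Lemma involutions_agree_infinitely :
  exists G : (nat -> nat) -> nat -> nat -> nat, forall h, S_omega h ->
    (forall i, I_omega (G h i)) /\
    forall E : set nat, infinite_set E -> (forall x, E x -> h x <> x) ->
      exists i, infinite_set [set x | E x /\ G h i x = h x].
Proof.
have /choice [g gP] : forall h, exists g : 'I_3 -> nat -> nat, S_omega h ->
    (forall i, I_omega (g i)) /\ forall x, h x <> x -> exists i, g i x = h x.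
  move=> h; have [/three_involutions [g gP]|] := pselect (S_omega h).
    by exists g.
  by exists (fun _ => id).
exists (fun h i => g h (inord i)) => h /gP [gI gh]; split=> // E infE Eh.
apply: contrapT => fin; apply: infE.
apply: (@sub_finite_set _ _
    (\bigcup_(i in [set: 'I_3]) [set x | E x /\ g h i x = h x])).
  by move=> x Ex; have [i gi] := gh _ (Eh _ Ex); exists i.
apply: bigcup_finite => // i _; apply: contrapT => inf; apply: fin.
by exists i; rewrite inord_val.
Qed.

(** * Families of bijections *)

(** A maximal independent set A is infinite: every point outside A is joined
    to A by an edge of some h in H, and each point has at most 2|H| neighbours. *)
Lemma finite_family_independent_set (H : set (nat -> nat)) :
  finite_set H -> H `<=` S_omega ->
  exists2 A, infinite_set A &
    forall h a, H h -> A a -> A (h a) -> a = h a.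
Proof.
move=> finH HS.
pose P (A : set nat) := forall h a, H h -> A a -> A (h a) -> a = h a.
have [F FP totF|A [AP maxA]] := @Zorn_bigcup _ P.
  move=> h a Hh [D FD Da] [E FE Eha].
  have [DE|ED] := totF _ _ FD FE.
    by apply: (FP _ FE h) => //; apply: DE.
  by apply: (FP _ FD h) => //; apply: ED.
exists A => // finA; apply: infinite_nat.
have finN : finite_set (A `|` \bigcup_(h in H) (h @` A `|` h @^-1` A)).
  rewrite finite_setU; split=> //; apply: bigcup_finite => // h Hh.
  rewrite finite_setU; split; first exact: finite_image.
  apply: finite_preimage => // x y _ _; apply: bij_inj; exact: HS.
apply: sub_finite_set finN => x _; apply: contrapT => nx.
have nAx : ~ A x by move=> Ax; apply: nx; left.
apply: (maxA (A `|` [set x])).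
  by split=> [a Aa|sub]; [left | apply: nAx; apply: sub; right].
move=> h a Hh [Aa|->] [Ahx|e] //.
- exact: AP.
- by case: nx; right; exists h => //; left; exists a.
- by case: nx; right; exists h => //; right.
Qed.

Definition Delta_family : set (set (nat -> nat)) := [set H | H `<=` S_omega /\
  forall A, infinite_subsets A ->
    exists2 h, H h & infinite_subsets [set a | [/\ A a, a <> h a & A (h a)]]].

Definition Sigma_family : set (set (nat -> nat)) := [set H | H `<=` S_omega /\
  forall A B, infinite_subsets A -> infinite_subsets B ->
    exists2 h, H h & infinite_subsets ((h @` A) `&` B)].

Lemma Delta_family_infinite (H : set (nat -> nat)) :
  Delta_family H -> infinite_set H.
Proof.
move=> [HS HD] finH.
have [A infA AP] := finite_family_independent_set finH HS.
have [h Hh] := HD _ infA; apply.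
suff -> : [set a | [/\ A a, a <> h a & A (h a)]] = set0 by exact: finite_set0.
by apply/seteqP; split=> // a [Aa ha Aha]; apply: ha; apply: AP.
Qed.

(** Applied to disjoint infinite subsets of A and B, the property of H yields
    points that are moved. *)
Lemma Sigma_family_moving (H : set (nat -> nat)) (A B : set nat) :
  Sigma_family H -> infinite_set A -> infinite_set B ->
  exists2 h, H h & infinite_set [set a | [/\ A a, a <> h a & B (h a)]].
Proof.
move=> [_ HS] infA infB.
have [s [t [s_inj t_inj sA tB st]]] := disjoint_infinite_seqs infA infB.
have [h Hh inf] := HS _ _ (infinite_range_inj s_inj) (infinite_range_inj t_inj).
exists h => // fin; apply: inf; apply: sub_finite_set (finite_image h fin).
move=> _ [[_ [m _ <-] <-] [n _ tn]]; exists (s m) => //; split=> //; last by rewrite -tn.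
by rewrite -tn.
Qed.

Lemma Sigma_sub_Delta : Sigma_family `<=` Delta_family.
Proof.
move=> H HS; split=> [|A infA]; first by case: HS.
exact: Sigma_family_moving.
Qed.

(** Witnesses that the two minima are taken over nonempty families: for disjoint
    sequences s in A and t in B, some involution exchanges s n and t n. *)
Lemma Sigma_family_S_omega : Sigma_family S_omega.
Proof.
split=> // A B infA infB.
have [s [t [s_inj t_inj sA tB st]]] := disjoint_infinite_seqs infA infB.
have [|q [Sq _ _] qM] := @matching_I_omega
    [set p | exists n, p = (s n, t n) \/ p = (t n, s n)].
  split=> [x [n [] [-> e]]|x y [n [] [-> ->]]|x y z [m [] [-> ->]] [n [] [e ->]]].
  - exact: st e.
  - exact: st (esym e).
  - by exists n; right.
  - by exists n; left.
  - by rewrite (s_inj _ _ e).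
  - by case: (st _ _ e).
  - by case: (st _ _ (esym e)).
  - by rewrite (t_inj _ _ e).
exists q => //; apply: sub_infinite_set (infinite_range_inj t_inj).
move=> _ [n _ <-]; split=> //; exists (s n) => //.
by apply: qM; exists n; left.
Qed.

Lemma involution_family (H : set (nat -> nat)) :
  infinite_set H -> H `<=` S_omega ->
  exists2 H', H' `<=` I_omega /\ H' #<= H &
    forall h (E : set nat), H h -> infinite_set E ->
      (forall x, E x -> h x <> x) ->
      exists2 g, H' g & infinite_set [set x | E x /\ g x = h x].
Proof.
move=> infH HS; have [G GP] := involutions_agree_infinitely.
exists [set G p.1 p.2 | p in H `*` [set: nat]].
  split; first by move=> _ [[h i] [/= Hh _] <-]; have [] := GP _ (HS _ Hh).
  exact: card_le_trans (card_image_le _ _) (card_le_setX_nat infH).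
move=> h E Hh infE Eh; have [_ /(_ E infE Eh) [i infi]] := GP _ (HS _ Hh).
by exists (G h i) => //; exists (h, i).
Qed.

Lemma infinite_edges_image (g h : nat -> nat) (A B : set nat) : injective g ->
  infinite_set [set x | [/\ A x, x <> h x & B (h x)] /\ g x = h x] ->
  infinite_set (g @` A `&` B).
Proof.
move=> g_inj /(infinite_image_inj g_inj); apply: sub_infinite_set.
by move=> _ [x [[Ax _ Bhx] gx] <-]; split; [exists x | rewrite gx].
Qed.

Lemma I_omega_inj h : I_omega h -> injective h.
Proof. by case=> /bij_inj. Qed.

Theorem theorem4p21 :
  is_min_card [set H : set (nat -> nat) | H `<=` I_omega /\
    forall A, infinite_subsets A ->
      exists2 h, H h & infinite_subsets ((h @` A) `&` A)] Delta
  /\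
  is_min_card [set H : set (nat -> nat) | H `<=` I_omega /\
    forall A B, infinite_subsets A -> infinite_subsets B ->
      exists2 h, H h & infinite_subsets ((h @` A) `&` B)] Sigma.
Proof.
have IS : I_omega `<=` S_omega by move=> h [].
split; apply: is_min_card_coinitial.
- by exists S_omega; apply: Sigma_sub_Delta; apply: Sigma_family_S_omega.
- move=> H [HI HA]; split=> [|A infA]; first exact: subset_trans IS.
  have [h Hh inf] := HA _ infA; have [_ _ hfix] := HI _ Hh.
  exists h => // fin; apply: inf.
  apply: (@sub_finite_set _ _
     (h @` [set a | [/\ A a, a <> h a & A (h a)]] `|` [set x | h x = x])).
    move=> _ [[a Aa <-] Aha]; have [ha|ha] := pselect (a = h a).
      by right; rewrite /= -!ha.
    by left; exists a.
  rewrite finite_setU; split; first exact: finite_image.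
  have [[x hx]|nofix] := pselect (exists x, h x = x).
    by apply: (sub_finite_set _ (finite_set1 x)) => y hy; apply: hfix.
  by apply: (sub_finite_set _ (@finite_set0 nat)) => y hy; case: nofix; exists y.
- move=> H HD; have infH := Delta_family_infinite HD.
  have [H' [H'I H'H] H'P] := involution_family infH HD.1.
  exists H' => //; split=> // A infA; have [_ HA] := HD.
  have [h Hh inf] := HA _ infA.
  have [x [_ /nesym] //|g H'g infg] := H'P _ _ Hh inf.
  exists g => //; apply: infinite_edges_image infg.
  exact/I_omega_inj/H'I.
- by exists S_omega; apply: Sigma_family_S_omega.
- by move=> H [HI HA]; split=> //; apply: subset_trans IS.
- move=> H HS.
  have infH := Delta_family_infinite (Sigma_sub_Delta HS).
  have [H' [H'I H'H] H'P] := involution_family infH HS.1.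
  exists H' => //; split=> // A B infA infB.
  have [h Hh inf] := Sigma_family_moving HS infA infB.
  have [x [_ /nesym] //|g H'g infg] := H'P _ _ Hh inf.
  exists g => //; apply: infinite_edges_image infg.
  exact/I_omega_inj/H'I.
Qed.
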